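(* Let $p\in K(\beta\mathbb{N},\cdot)$. Then $\mathbb{N}^*\setminus\{p\}$ is not normal.
   Context: $\mathbb{N}=\{1,2,3,\dots\}$ is discrete. $\beta\mathbb{N}$ is the set of ultrafilters on $\mathbb{N}$ (principal ultrafilters identified with points of $\mathbb{N}$), with the topology whose basic clopen sets are $\overline{A}=\{p\in\beta\mathbb{N}: A\in p\}$, $A\subseteq\mathbb{N}$; $\mathbb{N}^*=\beta\mathbb{N}\setminus\mathbb{N}$ with the subspace topology. Multiplication extends to $\beta\mathbb{N}$ by: $A\in p\cdot q$ iff $\{x\in\mathbb{N}: x^{-1}A\in q\}\in p$, where $x^{-1}A=\{y\in\mathbb{N}: x\cdot y\in A\}$. This makes $(\beta\mathbb{N},\cdot)$ a compact Hausdorff right topological semigroup, and $K(\beta\mathbb{N},\cdot)$ is its smallest two-sided ideal. *)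

(* Defs.v *)
From HB Require Import structures.
From mathcomp Require Import all_boot.
From mathcomp Require Import all_classical all_reals all_analysis.

Set Implicit Arguments.
Unset Strict Implicit.
Unset Printing Implicit Defensive.

Local Open Scope classical_set_scope.

Record beta (T : Type) : Type := Beta {
  beta_sets :> (T -> Prop) -> Prop;
  beta_ultra : UltraFilter beta_sets }.

#[global] Existing Instance beta_ultra.

HB.instance Definition _ (T : Type) := gen_eqMixin (beta T).
HB.instance Definition _ (T : Type) := gen_choiceMixin (beta T).

Definition beta_principal (T : Type) (x : T) : beta T :=
  Beta (principal_filter_ultra x).

Definition beta_remainder (T : Type) : set (beta T) :=
  ~` range (@beta_principal T).
Arguments beta_remainder T : clear implicits.

Lemma beta_inj (T : Type) (p q : beta T) :
  beta_sets p = beta_sets q -> p = q.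
Proof.
case: p q => [F FU] [G GU] /= FG; case: _ / FG in GU *.
by congr Beta; exact: Prop_irrelevance.
Qed.

Lemma beta_ultra_of_setVsetC (T : Type) (F : set_system T) :
  ProperFilter F -> (forall A, F A \/ F (~` A)) -> UltraFilter F.
Proof.
move=> FF FC; split=> // G GF FG; rewrite eqEsubset; split=> // A GA.
have [//|/FG GnA] := FC A.
by have /filter_ex [x []] : G (A `&` ~` A) by exact: filterI.
Qed.

Section beta_topology.
Variable T : Type.

Definition beta_clopen (A : set T) : set (beta T) := [set p : beta T | p A].

Lemma beta_clopen_cover : \bigcup_(A in setT) beta_clopen A = setT.
Proof. by rewrite -subTset => p _; exists setT => //; exact: filterT. Qed.

Lemma beta_clopen_join (A B : set T) (p : beta T) :
  setT A -> setT B -> beta_clopen A p -> beta_clopen B p ->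
  exists C, [/\ setT C, beta_clopen C p &
                beta_clopen C `<=` beta_clopen A `&` beta_clopen B].
Proof.
move=> _ _ pA pB; exists (A `&` B); split=> //; first exact: filterI.
by move=> q qAB; split; apply: filterS qAB => x [].
Qed.

HB.instance Definition _ :=
  isBaseTopological.Build (beta T) beta_clopen_cover beta_clopen_join.

End beta_topology.

Section beta_mul.
Variable S : semigroupType.

Definition beta_mul_sets (p q : beta S) : set_system S :=
  [set A | p [set x | q [set y | A (x * y)%g]]].

Lemma beta_mul_ultra (p q : beta S) : UltraFilter (beta_mul_sets p q).
Proof.
have FF : Filter (beta_mul_sets p q).
  split.
  - by apply: (filterE (F := p)) => x; exact: filterT.
  - move=> A B; apply: (filterS2 (F := p)) => x; exact: filterI.
  - by move=> A B AB; apply: (filterS (F := p)) => x; apply: filterS => y /AB.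
apply: beta_ultra_of_setVsetC.
  apply: Build_ProperFilter_ex => A pA.
  have [x qA] := filter_ex (F := p) pA.
  by have [y Axy] := filter_ex qA; exists (x * y)%g.
move=> A; have [|pn] := in_ultra_setVsetC [set x | q [set y | A (x * y)%g]]
  (beta_ultra p); first by left.
right; apply: filterS pn => x /= nq.
by have [//|] := in_ultra_setVsetC [set y | A (x * y)%g] (beta_ultra q).
Qed.

Definition beta_mul (p q : beta S) : beta S := Beta (beta_mul_ultra p q).

Lemma beta_mulA : associative beta_mul.
Proof.
move=> p q r; apply: beta_inj; apply/funext => A.
rewrite /= /beta_mul_sets /= /beta_mul_sets /=.
congr (beta_sets p _); apply/funext => x /=.
congr (beta_sets q _); apply/funext => y /=.
by congr (beta_sets r _); apply/funext => z /=; rewrite mulgA.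
Qed.

HB.instance Definition _ := isSemigroup.Build (beta S) beta_mulA.

End beta_mul.

(* Nonemptiness matters: otherwise set0 would be the smallest ideal. *)
Definition two_sided_ideal (S : semigroupType) (I : set S) : Prop :=
  I !=set0 /\ forall x y, I x -> I (x * y)%g /\ I (y * x)%g.

(* The intersection of all two-sided ideals.  It may be empty for a general S;
   it is itself an ideal when S is a compact Hausdorff right topological
   semigroup. *)
Definition smallest_ideal (S : semigroupType) : set S :=
  smallest (@two_sided_ideal S) set0.
Arguments smallest_ideal S : clear implicits.

Definition posnat : Type := {n : nat | (0 < n)%N}.

HB.instance Definition _ := Choice.on posnat.

Lemma posnat_mul_gt0 (m n : posnat) : (0 < val m * val n)%N.
Proof. by rewrite muln_gt0 (valP m) (valP n). Qed.

Definition posnat_mul (m n : posnat) : posnat :=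
  exist _ (val m * val n)%N (posnat_mul_gt0 m n).

Lemma posnat_mulA : associative posnat_mul.
Proof. by move=> m n k; apply: val_inj; exact: mulnA. Qed.

HB.instance Definition _ := isSemigroup.Build posnat posnat_mulA.

(* Main.v *)
Require Import Defs.
From mathcomp Require Import all_boot.
From mathcomp Require Import all_classical all_reals all_analysis.
Local Open Scope classical_set_scope.

(** Let [p] lie in the smallest ideal, and let [L] be the left ideal generated
    by [p]: it is the closure of the countable set of translates [n * p], [n]
    a positive integer, and it is a minimal left ideal.  Countable subsets of
    the remainder behave as in an extremally disconnected space: if [U] and
    [V] are disjoint and open in the remainder minus [p], then the translates
    in [U] and the translates in [V] can be put into disjoint sets of integers
    ([countable_separation]), so they cannot both accumulate at [p].  Hence it
    is enough to find two disjoint closed subsets of the remainder minus [p],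
    each of which has [p] as a limit of points of [L]: a neighbourhood of such
    a set contains translates [n * p] arbitrarily close to [p]
    ([wing_adherent]).

    These two closed sets are the wings of [p].  Take a family of parity
    characters of the positive integers, indexed by the sets [X] of natural
    numbers, that are independent: finitely many of them take any prescribed
    values ([independent_parities]).  Attach to each member [A] of [p] its own
    index.  The wing of colour [b] consists of the [u] such that, for every
    [A] in [p], either [A] belongs to [u] or the character attached to [A] has
    value [b] at [u].  A point in both wings contains all members of [p], so
    it is [p].

    That the wings reach [p] is where minimality enters.  If [A] is in [p],
    finitely many preimages under translations of the clopen set defined by
    [A] cover [L] ([smallest_ideal_syndetic]).  A clopen set with this property
    cannot miss patterns of the characters on infinitely many disjoint finite
    sets of indices, so outside a finite set of indices the characters remain
    independent on it ([syndetic_pattern_free]).  Starting with any [W] in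
    [p], one intersects successively with those [A] in [p] whose index is in
    the finite exceptional set of the set reached so far.  After countably
    many steps every [A] in [p] either contains the intersection or has an
    index at which the character may still be chosen freely; choosing the
    colour [b] there, and at one spare index the value that differs from the
    one at [p], gives a point of the wing other than [p] that contains [W]
    ([wing_point]). *)

(** * Ultrafilters *)

Lemma beta_setC {T : Type} (p : beta T) (A : set T) : p (~` A) <-> ~ p A.
Proof.
split=> [pnA pA|npA].
  by have [x []] : exists x, (A `&` ~` A) x by exact/(filter_ex (F := p))/filterI.
by have [|//] := in_ultra_setVsetC A (beta_ultra p).
Qed.

Lemma beta_ext {T : Type} (p q : beta T) : (forall A, p A -> q A) -> p = q.
Proof.
move=> pq; apply: beta_inj; rewrite predeqE => A; split=> [|qA]; first exact: pq.
by apply: contrapT => /beta_setC /pq /beta_setC.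
Qed.

Lemma beta_of_filter {T : Type} {F : set_system T} :
  ProperFilter F -> exists u : beta T, F `<=` u.
Proof. by move=> /ultraFilterLemma[G [GU FG]]; exists (Beta GU). Qed.

Lemma filter_all_seq {T : Type} {J : eqType} (F : set_system T)
    (s : seq J) (D : J -> set T) :
  Filter F -> (forall j, j \in s -> F (D j)) ->
  F [set y | forall j, j \in s -> D j y].
Proof.
move=> FF; elim: s => [_|j s IHs sF]; first by apply: filterE.
have Fs : F [set y | forall j, j \in s -> D j y].
  by apply: IHs => i is_; apply: sF; rewrite inE is_ orbT.
have Fj : F (D j) by apply: sF; rewrite mem_head.
apply: filterS2 Fj Fs => y Djy sy i; rewrite inE => /orP[/eqP ->//|].
exact: sy.
Qed.

(** The usual disjointification, in which each set gives up what the opposite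
    sets of smaller or equal index contain, is harmless: only finitely many
    sets are removed, none of which belongs to the ultrafilter in question. *)
Lemma countable_separation {S : Type} (d : nat -> beta S) (A B : nat -> set S) :
  (forall i j, ~ d i (A i `&` B j)) -> (forall i j, ~ d j (A i `&` B j)) ->
  exists C D, [/\ C `&` D = set0, forall i, d i (A i) -> d i C &
                  forall j, d j (B j) -> d j D].
Proof.
move=> dAB dBA.
exists [set y | exists i, A i y /\ forall j, j \in iota 0 i.+1 -> (~` B j) y].
exists [set y | exists j, B j y /\ forall i, i \in iota 0 j.+1 -> (~` A i) y].
split=> [|i Ai|j Bj].
- apply/seteqP; split=> // y [[i [Ai nB]] [j [Bj nA]]].
  have [ij|ji] := leqP i j.
    have i_iota : i \in iota 0 j.+1 by rewrite mem_iota.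
    exact: (nA i i_iota Ai).
  have j_iota : j \in iota 0 i.+1 by rewrite mem_iota add0n ltnS (ltnW ji).
  exact: (nB j j_iota Bj).
- have nB : d i [set y | forall j, j \in iota 0 i.+1 -> (~` B j) y].
    apply: filter_all_seq => j _; apply/beta_setC => Bj.
    by apply: (dAB i j); exact: (filterI (F := d i)).
  by apply: (filterS2 (F := d i)) Ai nB => y Aiy nBy; exists i.
- have nA : d j [set y | forall i, i \in iota 0 j.+1 -> (~` A i) y].
    apply: filter_all_seq => i _; apply/beta_setC => Ai.
    by apply: (dBA i j); exact: (filterI (F := d j)).
  by apply: (filterS2 (F := d j)) Bj nA => y Bjy nAy; exists j.
Qed.

(** * Recurrence in the smallest ideal *)

Definition ldiv (n : posnat) (A : set posnat) : set posnat :=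
  [set y | A (n * y)%g].

Lemma ldivM (m n : posnat) (A : set posnat) :
  ldiv n (ldiv m A) = ldiv (m * n)%g A.
Proof. by apply/funext => y; rewrite /ldiv /= mulgA. Qed.

Definition posnat_succ (k : nat) : posnat := exist _ k.+1 isT.

Lemma posnat_predK (n : posnat) : posnat_succ (val n).-1 = n.
Proof. by apply: val_inj => /=; rewrite prednK// (valP n). Qed.

Lemma ldiv1 (A : set posnat) : ldiv (posnat_succ 0) A = A.
Proof.
apply/funext => y; rewrite /ldiv /=; congr A.
by apply: val_inj; exact: mul1n.
Qed.

Definition left_invariant (F : set_system posnat) :=
  forall n A, F A -> F (ldiv n A).

(** Left invariant filters correspond to the nonempty closed left ideals, and
    the maximal ones to the minimal left ideals. *)
Lemma maximal_left_invariant_filter : exists F : set_system posnat,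
  [/\ ProperFilter F, left_invariant F &
      forall G, ProperFilter G -> left_invariant G -> F `<=` G -> G `<=` F].
Proof.
(* [P] is phrased so as to hold for the empty family, the union of the empty
   chain. *)
pose P (F : set_system posnat) := [/\ ~ F set0,
  forall A B, F A -> F B -> F (A `&` B),
  forall A B, A `<=` B -> F A -> F B & left_invariant F].
have PF F : P F -> F !=set0 -> ProperFilter F.
  move=> [F0 FI FS FL] [A FA]; split=> //; split=> //.
  by apply: FS FA => x.
have [|F [PFF Fmax]] := @Zorn_bigcup _ P.
  move=> C CP Ctot; split.
  - by move=> [F CF F0]; have [] := CP _ CF.
  - move=> A B [F CF FA] [G CG GB].
    have [FG|GF] := Ctot _ _ CF CG.
      by exists G => //; have [_ + _ _] := CP _ CG; apply=> //; exact: FG.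
    by exists F => //; have [_ + _ _] := CP _ CF; apply=> //; exact: GF.
  - move=> A B AB [F CF FA]; exists F => //.
    by have [_ _ + _] := CP _ CF; apply; [exact: AB|].
  - by move=> n A [F CF FA]; exists F => //; have [_ _ _] := CP _ CF; apply.
have F_neq0 : F !=set0.
  apply: contrapT => F0.
  apply: (Fmax [set setT]); first split.
  - by move=> A FA; case: F0; exists A.
  - by move/(_ setT erefl) => FT; case: F0; exists setT.
  - split.
    + move=> /= eT; suff: (set0 : set posnat) (posnat_succ 0) by [].
      by rewrite eT.
    + by move=> _ _ -> ->; rewrite setTI.
    + by move=> A B AB AT; apply/seteqP; split=> // x _; apply: AB; rewrite AT.
    + by move=> n _ ->; apply/funext => y; rewrite /ldiv /=.
exists F; have [_ _ _ FL] := PFF; split=> //; first exact: PF.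
move=> G GF GL FG A GA; apply: contrapT => FA.
apply: (Fmax G); first by split=> // /(_ _ GA).
split=> //.
- by move=> B D; exact: filterI.
- by move=> B D; exact: filterS.
Qed.

(** Points of minimal left ideals are uniformly recurrent.  With [F] a maximal
    left invariant filter, the products [m * y] with [m] finer than [F] form
    an ideal, so [p = m * y], and the claim for [A] and [p] becomes one for [m]
    and a set [C] in [m].  If it failed for [C], the complement of [C] would
    belong to a left invariant filter finer than [F], hence to [F] and to
    [m]. *)
Lemma smallest_ideal_syndetic (p : beta posnat) (A : set posnat) :
  smallest_ideal (beta posnat) p -> p A ->
  exists G : seq posnat, forall n, exists2 g, g \in G & p (ldiv (g * n)%g A).
Proof.
move=> Kp pA; have [F [FF FL Fmax]] := maximal_left_invariant_filter.
pose I := [set u : beta posnat | exists m y : beta posnat,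
  F `<=` m /\ u = (m * y)%g].
have Iideal : two_sided_ideal I.
  split.
    by have [m Fm] := beta_of_filter FF; exists (m * m)%g, m, m.
  move=> u v [m [y [Fm ->]]]; split.
    by exists m, (y * v)%g; rewrite mulgA.
  exists (v * m)%g, y; rewrite mulgA; split=> // B FB.
  by apply: (filterE (F := v)) => x; exact/Fm/FL.
have [m [y [Fm pE]]] : I p by apply: Kp; split.
have ymulE B n : p (ldiv n B) = m (ldiv n [set x | y (ldiv x B)]).
  by rewrite pE; congr (beta_sets m _); apply/funext => x; rewrite /ldiv /=;
     congr (beta_sets y _); apply/funext => z; rewrite /= mulgA.
set C := [set x | y (ldiv x A)] in ymulE *.
have mC : m C by rewrite -(ldiv1 C) -ymulE ldiv1.
apply: contrapT => nG.
have {}nG (G : seq posnat) :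
    exists n, forall g, g \in G -> ~ m (ldiv (g * n)%g C).
  apply: contrapT => nn; apply: nG; exists G => n; apply: contrapT => ng.
  by apply: nn; exists n => g gG mg; apply: ng; exists g => //; rewrite ymulE.
(* [F'] is the trace on the translates of [m] of the left ideal of those points
   whose orbits avoid [C]; by [nG] that ideal is not empty. *)
pose F' := [set B : set posnat | exists G : seq posnat, forall n,
  (forall g, g \in G -> ~ m (ldiv (g * n)%g C)) -> m (ldiv n B)].
have F'F : ProperFilter F'.
  split; last split.
  - move=> [G GP]; have [n /GP m0] := nG G.
    by have := @filter_not_empty _ (beta_sets m) _; apply; apply: filterS m0.
  - by exists [::] => n _; exact: filterT.
  - move=> B D [G1 B1] [G2 D2]; exists (G1 ++ G2) => n nG12.
    apply: (filterI (F := m)).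
      by apply: B1 => g gG; apply: nG12; rewrite mem_cat gG.
    by apply: D2 => g gG; apply: nG12; rewrite mem_cat gG orbT.
  - move=> B D BD [G GB]; exists G => n /GB; apply: (filterS (F := m)).
    by move=> x; exact: BD.
have F'L : left_invariant F'.
  move=> k B [G GB]; exists [seq (g * k)%g | g <- G] => n ng.
  rewrite ldivM; apply: GB => g gG; rewrite mulgA; apply: ng.
  exact: map_f.
have FF' : F `<=` F' by move=> B FB; exists [::] => n _; exact/Fm/FL.
have /(Fmax _ F'F F'L FF') /Fm /beta_setC // : F' (~` C).
exists [:: posnat_succ 0] => n /(_ (posnat_succ 0) (mem_head _ _)) nC.
apply/(beta_setC m (ldiv n C)).
by rewrite -ldivM ldiv1 in nC.
Qed.

Lemma beta_remainderP (p : beta posnat) :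
  beta_remainder posnat p <-> forall k, ~ p [set k].
Proof.
split=> [pN k pk|pN [k _ kp]].
  apply: pN; exists k => //; apply: beta_ext => A /principal_filterP Ak.
  by apply: (filterS (F := p)) pk => _ ->.
by apply: (pN k); rewrite -kp; exact/principal_filterP.
Qed.

Lemma beta_remainder_mull (w p : beta posnat) :
  beta_remainder posnat p -> beta_remainder posnat (w * p)%g.
Proof.
move=> /beta_remainderP pN; apply/beta_remainderP => k wpk.
have [n pn] : exists n, p (ldiv n [set k]) := filter_ex (F := w) wpk.
have [y nyk] := filter_ex (F := p) pn.
apply: (pN y); apply: (filterS (F := p)) pn => z nzk.
apply: val_inj; apply/eqP; rewrite -(eqn_pmul2l (valP n)).
by apply/eqP; exact: (congr1 val (etrans nzk (esym nyk))).
Qed.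

(** A principal [p] would not be recurrent: [g * 2 * k] differs from [k]. *)
Lemma smallest_ideal_remainder (p : beta posnat) :
  smallest_ideal (beta posnat) p -> beta_remainder posnat p.
Proof.
move=> Kp; apply/beta_remainderP => k pk.
have [G /(_ (posnat_succ 1))[g _ pg]] := smallest_ideal_syndetic _ _ Kp pk.
have [y [gyk yk]] := filter_ex (F := p) (filterI (F := p) pg pk).
have gk : (val g * 2 * val k)%N = val k.
  by rewrite -[RHS](congr1 val gyk) [y]yk.
have := leqnn (val k); rewrite -{1}gk leqNgt => /negP; apply.
rewrite -[ltnLHS]mul1n ltn_pmul2r ?(valP k)//.
by rewrite (@leq_trans 2)// leq_pmull// (valP g).
Qed.

(** * Independent parity characters *)

Lemma prime_enumeration :
  exists f : nat -> nat, injective f /\ forall k, prime (f k).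
Proof.
pose f := fix f k := if k is k'.+1 then s2val (prime_above (f k')) else 2.
have f_prime k : prime (f k).
  by case: k => // k; exact: (s2valP' (prime_above (f k))).
have f_lt : {homo f : i j / i < j}.
  apply: homo_ltn => [x y z|k]; first exact: ltn_trans.
  exact: (s2valP (prime_above (f k))).
exists f; split=> // i j; move: f f_lt {f_prime} => f f_lt fij.
by have [/f_lt|/f_lt|//] := ltngtP i j; rewrite fij ltnn.
Qed.

Definition prime_count (Y : pred nat) (n : nat) : nat :=
  \sum_(q < n.+1 | Y q) logn q n.

Lemma prime_count_widen (Y : pred nat) (n N : nat) :
  n < N -> prime_count Y n = \sum_(q < N | Y q) logn q n.
Proof.
move=> ltnN; rewrite /prime_count.
rewrite (big_ord_widen_cond N Y (fun q => logn q n)) //.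
rewrite [RHS](bigID (fun q : 'I_N => q < n.+1)) /=.
rewrite [X in _ = _ + X]big1 ?addn0 // => q /andP[_].
by rewrite -leqNgt => /ltn_log0.
Qed.

Lemma prime_countM (Y : pred nat) (m n : nat) : 0 < m -> 0 < n ->
  prime_count Y (m * n) = prime_count Y m + prime_count Y n.
Proof.
move=> m0 n0; rewrite (@prime_count_widen Y m (m * n).+1) ?ltnS ?leq_pmulr//.
rewrite (@prime_count_widen Y n (m * n).+1) ?ltnS ?leq_pmull//.
by rewrite -big_split; apply: eq_bigr => q _; rewrite lognM.
Qed.

Lemma prime_count_prime (Y : pred nat) (q : nat) :
  prime q -> prime_count Y q = Y q.
Proof.
move=> pq; rewrite /prime_count big_mkcond big_ord_recr /= big1 => [|i _].
  by rewrite logn_prime// eqxx; case: (Y q).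
by rewrite logn_prime// ltn_eqF//; case: ifP.
Qed.

Definition set_prefix (X : set nat) (k : nat) : seq bool :=
  mkseq (fun i => `[< X i >]) k.

Lemma set_prefix_separates (e : seq (set nat)) :
  exists k, {in e &, injective (set_prefix^~ k)}.
Proof.
have sep2 (X Z : set nat) : exists k, forall l, (k <= l)%N ->
    set_prefix X l = set_prefix Z l -> X = Z.
  have [->|XZ] := pselect (X = Z); first by exists 0.
  have [i Xi] : exists i, `[< X i >] != `[< Z i >].
    apply: contrapT => nXZ; apply: XZ; apply/funext => i.
    apply/propext; have [XZi|XZi] := eqVneq `[< X i >] `[< Z i >].
      by split=> /asboolP; [rewrite XZi|rewrite -XZi] => /asboolP.
    by case: nXZ; exists i.
  exists i.+1 => l il /(congr1 (fun s => nth true s i)).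
  by rewrite !nth_mkseq// => /eqP; rewrite (negbTE Xi).
have sep1 X : exists k, forall l, (k <= l)%N -> forall Z, Z \in e ->
    set_prefix X l = set_prefix Z l -> X = Z.
  elim: e => [|Z e [k kP]]; first by exists 0.
  have [k' k'P] := sep2 X Z; exists (maxn k k') => l.
  rewrite geq_max => /andP[kl k'l] Z'; rewrite inE => /orP[/eqP ->|].
    exact: k'P.
  exact: kP.
have [f fP] := choice sep1.
exists (\max_(X <- e) f X) => X Z Xe Ze; apply: fP => //.
by rewrite (big_rem X) //= leq_maxl.
Qed.

(** The classical independent family of continuum many subsets of a countable
    set, here the set of pairs of a length [l] and a finite set [B] of binary
    words, which is identified with [nat] by [pickle]. *)
Definition independent_family (X : set nat) (k : nat) : bool :=
  if unpickle k : option (nat * seq (seq bool)) is Some (l, B)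
  then set_prefix X l \in B else false.

(** Transport of the independent family to the primes: the parity of the
    number of prime factors, with multiplicity, taken among the primes that
    [X] selects.  Values prescribed on finitely many [X] are realized by a
    single prime. *)
Lemma independent_parities : exists chi : set nat -> posnat -> bool,
  (forall X m n, chi X (m * n)%g = chi X m (+) chi X n) /\
  forall (e : seq (set nat)) (t : set nat -> bool),
    exists n, forall X, X \in e -> chi X n = t X.
Proof.
have [f [f_inj f_prime]] := prime_enumeration.
exists (fun X n => odd (prime_count
  [pred q | `[< exists2 k, q = f k & independent_family X k >]] (val n))).
split=> [X m n|e t].
  by rewrite prime_countM ?oddD//; [exact: (valP m)|exact: (valP n)].
have [l le] := set_prefix_separates e.
have [k kE] : exists k, unpickle k =
    Some (l, [seq set_prefix X l | X <- e & t X]).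
  by exists (pickle (l, [seq set_prefix X l | X <- e & t X])); rewrite pickleK.
exists (exist _ (f k) (prime_gt0 (f_prime k))) => X Xe.
rewrite prime_count_prime//= oddb.
have -> : t X = independent_family X k.
  rewrite /independent_family kE; apply/idP/mapP => [tX|[Z]].
    by exists X => //; rewrite mem_filter tX.
  by rewrite mem_filter => /andP[tZ Ze] /le -> .
apply/asboolP/idP => [[k' /f_inj ->]//|Xk].
by exists k.
Qed.

(** * Freeness of the characters near [p] *)

(** Seen through the characters, the clopen part of the left ideal of [p] given
    by [A] is as large as a basic open set of a Cantor cube, which constrains
    only the finitely many coordinates in [E]. *)
Definition pattern_free {J : eqType} (chi : J -> posnat -> bool)
    (p : beta posnat) :=
  forall A, p A -> exists E : seq J, forall (e : seq J) (t : J -> bool),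
    (forall j, j \in e -> j \notin E) ->
    exists n, p (ldiv n A) /\ forall j, j \in e -> chi j n = t j.

(** If no finite set [E] worked for [A], there would be patterns, on as many
    disjoint finite sets of indices as desired, that no translate containing
    [A] realizes.  Take one for each element [g] of the finite set [G] given
    by recurrence and choose [n] such that [g * n] realizes the pattern of
    [g]: then no [g * n * p] contains [A]. *)
Lemma syndetic_pattern_free {J : eqType} (chi : J -> posnat -> bool)
    (p : beta posnat) :
  (forall j m n, chi j (m * n)%g = chi j m (+) chi j n) ->
  (forall (e : seq J) (t : J -> bool),
     exists n, forall j, j \in e -> chi j n = t j) ->
  (forall A, p A -> exists G : seq posnat,
     forall n, exists2 g, g \in G & p (ldiv (g * n)%g A)) ->
  pattern_free chi p.
Proof.
move=> chiM chi_indep p_synd A /p_synd[G Gsynd]; apply: contrapT => nE.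
have bad (E : seq J) : exists (e : seq J) (t : J -> bool),
    (forall j, j \in e -> j \notin E) /\
    forall n, (forall j, j \in e -> chi j n = t j) -> ~ p (ldiv n A).
  apply: contrapT => nbad; apply: nE; exists E => e t eE.
  apply: contrapT => nn; apply: nbad; exists e, t; split=> // n nt pn.
  by apply: nn; exists n.
have [e [t et]] : exists (e : seq J) (t : J -> bool), forall n,
    (forall j, j \in e -> chi j n = t j) ->
    forall g, g \in G -> ~ p (ldiv (g * n)%g A).
  elim: (G) => [|g G' [e [t et]]]; first by exists [::], (fun=> true).
  have [e' [t' [e'e e't']]] := bad e.
  exists (e' ++ e), (fun j => if j \in e' then t' j (+) chi j g else t j).
  move=> n nt h; rewrite inE => /orP[/eqP ->|].
    apply: e't' => j je'; rewrite chiM nt ?mem_cat ?je' //.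
    by rewrite addbC -addbA addbb addbF.
  apply: et => j je; rewrite nt ?mem_cat ?je ?orbT //.
  by case: ifP => // /e'e; rewrite je.
have [n nt] := chi_indep e t.
by have [g gG] := Gsynd n; exact: et.
Qed.

(** * The wings of [p] *)

(** The index attached to a set of positive integers.  It never contains [0],
    so that the indices containing [0] stay free for telling points of the
    wings from [p]. *)
Definition set_of_posnats (A : set posnat) : set nat := [set val a | a in A].

Definition posnats_of_set (X : set nat) : set posnat := [set a | X (val a)].

Lemma set_of_posnatsK : cancel set_of_posnats posnats_of_set.
Proof.
move=> A; apply/seteqP; split=> [a [b Ab /val_inj <-]//|a Aa].
by exists a.
Qed.

Lemma set_of_posnats0 (A : set posnat) : ~ set_of_posnats A 0.
Proof. by move=> [[a a0] _ /= a_eq0]; rewrite a_eq0 in a0. Qed.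

(** Cantor's diagonal argument. *)
Lemma set_outside_sequence (E : nat -> seq (set nat)) :
  exists X : set nat, X 0 /\ forall i, X \notin E i.
Proof.
pose f k := if (unpickle k : option (nat * nat)) is Some (i, l)
            then nth set0 (E i) l else set0.
exists [set k | if k is k'.+1 then ~ f k' k else True]; split=> // i.
set X := [set k | _]; apply/negP => XE.
have [k fk] : exists k, f k = X.
  by exists (pickle (i, index X (E i))); rewrite /f pickleK nth_index.
have XS : X k.+1 <-> ~ f k k.+1 by [].
rewrite fk in XS; have nX : ~ X k.+1 by move=> Xk; exact: (XS.1 Xk Xk).
exact: (nX (XS.2 nX)).
Qed.

(** The closing-off argument: the indices that are exceptional for some [V i]
    are countable in number, and each member of [p] having one of them as its
    index contains some [V i]; all other indices are free on every [V i]
    simultaneously, and compactness provides [w]. *)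
Lemma wing_point (chi : set nat -> posnat -> bool) (p : beta posnat)
    (b : bool) (W : set posnat) :
  (forall X m n, chi X (m * n)%g = chi X m (+) chi X n) ->
  pattern_free chi p -> p W ->
  exists w : beta posnat, [/\ (w * p)%g <> p, (w * p)%g W &
    forall A, p A -> (w * p)%g A \/
      (w * p)%g [set y | chi (set_of_posnats A) y = b]].
Proof.
move=> chiM free pW.
have E_ex A : exists E : seq (set nat), p A ->
    forall (e : seq (set nat)) (t : set nat -> bool),
      (forall X, X \in e -> X \notin E) ->
      exists n, p (ldiv n A) /\ forall X, X \in e -> chi X n = t X.
  by have [/free[E ?]|npA] := pselect (p A); [exists E|exists [::]].
have [E EP] := choice E_ex.
(* [V] decreases, and [V i.+1] is contained in each member of [p] whose index
   is exceptional for [V i]. *)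
pose next V := V `&` [set y | forall X, X \in E V ->
  p (posnats_of_set X) -> posnats_of_set X y].
pose V i := iter i next W.
have pV i : p (V i).
  elim: i => //= i pVi; apply: (filterI (F := p)) => //.
  apply: (filter_all_seq p (E (V i)) (fun X =>
    [set y | p (posnats_of_set X) -> posnats_of_set X y])) => X _.
  have [pX|npX] := pselect (p (posnats_of_set X)).
    by apply: (filterS (F := p)) pX => y Xy _.
  by apply: (filterS (F := p)) (filterT (F := p)) => y _ /npX.
have V_decr i j : (i <= j)%N -> V j `<=` V i.
  by move=> /subnK <-; elim: (j - i)%N => // k IHk y [/IHk].
have [X0 [X00 X0E]] := set_outside_sequence (E \o V).
(* [c] is the pattern of [p], and [t] the pattern wanted for [w * p]: the
   colour [b] at the indices of sets of positive integers, and a disagreement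
   with [p] at the spare ones. *)
pose c X := `[< p [set y | chi X y = true] >].
have pc X : p [set y | chi X y = c X].
  rewrite /c; case: asboolP => // /beta_setC; apply: (filterS (F := p)).
  by move=> y /=; case: (chi X y).
pose t (X : set nat) := if `[< X 0 >] then ~~ c X else b.
pose B (ie : nat * seq (set nat)) := [set n | p (ldiv n (V ie.1)) /\
  forall X, X \in ie.2 -> chi X n = t X (+) c X].
pose D := [set ie : nat * seq (set nat) |
  forall X, X \in ie.2 -> forall i, X \notin E (V i)].
have BF : ProperFilter (filter_from D B).
  apply: filter_from_proper.
    apply: filter_from_filter; first by exists (0, [::]).
    move=> [i e] [i' e'] De De'; exists (maxn i i', e ++ e').
      by move=> X /=; rewrite mem_cat => /orP[/De|/De'].
    move=> n [/= pn nt]; split; split=> /=.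
    - by apply: (filterS (F := p)) pn => y; apply: V_decr; rewrite leq_maxl.
    - by move=> X Xe; apply: nt; rewrite mem_cat Xe.
    - by apply: (filterS (F := p)) pn => y; apply: V_decr; rewrite leq_maxr.
    - by move=> X Xe; apply: nt; rewrite mem_cat Xe orbT.
  move=> [i e] De; have [n nP] := EP _ (pV i) e (fun X => t X (+) c X)
    (fun X Xe => De X Xe i).
  by exists n.
have [w Bw] := beta_of_filter BF.
have wV i : (w * p)%g (V i).
  have : w (B (i, [::])) by apply: Bw; exists (i, [::]).
  by apply: (filterS (F := w)) => n [].
have wt X : (forall i, X \notin E (V i)) -> (w * p)%g [set y | chi X y = t X].
  move=> XE; have : w (B (0, [:: X])).
    by apply: Bw; exists (0, [:: X]) => // Z; rewrite inE => /eqP ->.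
  apply: (filterS (F := w)) => n [_ /(_ X (mem_head _ _)) chin].
  apply: (filterS (F := p)) (pc X) => y /=; rewrite chiM chin => ->.
  by rewrite -addbA addbb addbF.
exists w; split.
- move=> wp; have := wt X0 X0E; rewrite wp => pt.
  have [y [/= + +]] := filter_ex (F := p) (filterI (F := p) pt (pc X0)).
  by rewrite /t asboolT// => ->; case: (c X0).
- exact: (wV 0).
- move=> A pA; have [[i Ai]|nA] :=
      pselect (exists i, set_of_posnats A \in E (V i)).
    left; apply: (filterS (F := (w * p)%g)) (wV i.+1) => y [_ /(_ _ Ai)] /=.
    by rewrite set_of_posnatsK; exact.
  right; have := wt (set_of_posnats A); rewrite /t asboolF; last first.
    exact: set_of_posnats0.
  by apply=> i; apply/negP => Ai; apply: nA; exists i.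
Qed.

(** * The punctured remainder *)

Lemma normal_disjoint_open {T : topologicalType} (A B : set T) :
  normal_space T -> closed A -> closed B -> A `&` B = set0 ->
  exists U V, [/\ open U, open V, A `<=` U, B `<=` V & U `&` V = set0].
Proof.
move=> nT cA cB AB0.
have : set_nbhs A (~` B).
  by apply/set_nbhsP; exists (~` B); split=> //;
    [exact: closed_openC|exact/disjoints_subset].
move=> /(nT A cA)[C /set_nbhsP[U [oU AU UC]] CB].
exists U, (~` closure C); split=> //.
- exact/closed_openC/closed_closure.
- by move=> x Bx /CB.
- by apply/disjoints_subset; rewrite setCK => x /UC; exact: subset_closure.
Qed.

Local Notation punctured p := (set_type (beta_remainder posnat `\ p)).

Lemma punctured_neq {p : beta posnat} (x : punctured p) : val x <> p.
Proof. by have /set_mem[] := valP x. Qed.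

Lemma punctured_lift (p u : beta posnat) :
  beta_remainder posnat u -> u <> p -> exists x : punctured p, val x = u.
Proof. by move=> uN up; exists (exist _ u (mem_set (conj uN up))). Qed.

(** Basic neighbourhoods of [x] can be taken to come from sets outside [p],
    since the space is Hausdorff. *)
Lemma open_punctured_basis {p : beta posnat} {U : set (punctured p)}
    {x : punctured p} : open U -> U x ->
  exists A, [/\ val x A, ~ p A & forall y : punctured p, val y A -> U y].
Proof.
move=> [_ [D _ <-] <-] [B DB xB].
have [B' xB' npB'] : exists2 B', val x B' & ~ p B'.
  apply: contrapT => nB'; apply: (punctured_neq x).
  by apply: beta_ext => B' xB'; apply: contrapT => npB'; apply: nB'; exists B'.
exists (B `&` B'); split.
- exact: (filterI (F := val x)).
- by move=> pBB'; apply: npB'; apply: (filterS (F := p)) pBB' => y [].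
- by move=> y yBB'; exists B => //; apply: (filterS (F := val y)) yBB' => z [].
Qed.

Lemma open_punctured_bases {p : beta posnat} {U : set (punctured p)}
    (d : nat -> beta posnat) : open U ->
  exists A : nat -> set posnat, forall i, [/\ ~ p (A i),
    forall y : punctured p, val y (A i) -> U y &
    forall x : punctured p, U x -> val x = d i -> d i (A i)].
Proof.
move=> oU; have A_ex i : exists A : set posnat, [/\ ~ p A,
    forall y : punctured p, val y A -> U y &
    forall x : punctured p, U x -> val x = d i -> d i A].
  have [[x [Ux xd]]|nx] := pselect (exists x, U x /\ val x = d i).
    have [A [xA npA AU]] := open_punctured_basis oU Ux.
    by exists A; split=> // _ _ _; rewrite -xd.
  exists set0; split.
  - exact: (@filter_not_empty _ (beta_sets p) _).
  - by move=> y /(@filter_not_empty _ (beta_sets (val y)) _).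
  - by move=> x Ux xd; case: nx; exists x.
by have [A AP] := choice A_ex; exists A.
Qed.

Lemma closed_trace (p : beta posnat) (A : set posnat) :
  closed [set x : punctured p | val x A].
Proof.
rewrite -openC; exists (beta_clopen (~` A)).
  by exists [set ~` A] => //; rewrite bigcup_set1.
by apply/seteqP; split=> x /beta_setC.
Qed.

Definition wing (chi : set nat -> posnat -> bool) (p : beta posnat) (b : bool) :
    set (punctured p) :=
  \bigcap_(A in p)
    [set x : punctured p | val x (A `|` [set y | chi (set_of_posnats A) y = b])].

Lemma closed_wing (chi : set nat -> posnat -> bool) (p : beta posnat) (b : bool) :
  closed (wing chi p b).
Proof. by apply: closed_bigI => A _; exact: closed_trace. Qed.

Lemma wing_disjoint (chi : set nat -> posnat -> bool) (p : beta posnat) :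
  wing chi p true `&` wing chi p false = set0.
Proof.
apply/seteqP; split=> // x [x1 x0]; apply: (punctured_neq x).
apply/esym; apply: beta_ext => A pA.
apply: (filterS2 (F := val x)) (x1 A pA) (x0 A pA) => y [//|/= ->].
by case.
Qed.

Definition translate (p : beta posnat) (k : nat) : beta posnat :=
  (beta_principal (posnat_succ k) * p)%g.

Lemma translateE (p : beta posnat) (k : nat) (A : set posnat) :
  translate p k A <-> p (ldiv (posnat_succ k) A).
Proof. by split=> [/principal_filterP//|pA]; exact/principal_filterP. Qed.

(** The wing, hence [U], has points [w * p] arbitrarily close to [p], and these
    are limits of translates of [p]; so [p] is adherent to the set of its
    translates that lie in [U]. *)
Lemma wing_adherent (chi : set nat -> posnat -> bool) (p : beta posnat)
    (b : bool) (U : set (punctured p)) (F : set posnat) :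
  beta_remainder posnat p ->
  (forall X m n, chi X (m * n)%g = chi X m (+) chi X n) ->
  pattern_free chi p -> open U -> wing chi p b `<=` U ->
  (forall (x : punctured p) k, U x -> val x = translate p k ->
     translate p k F) ->
  p F.
Proof.
move=> pN chiM free oU wU UF; apply: contrapT => /beta_setC pF.
have [w [wp_neq wpF wp_wing]] := wing_point chi p b (~` F) chiM free pF.
have [x xE] := punctured_lift _ _ (beta_remainder_mull w _ pN) wp_neq.
have Ux : U x.
  apply: wU => A pA; rewrite /= xE.
  have [wA|wA] := wp_wing _ pA; apply: (filterS (F := (w * p)%g)) wA => y.
    by left.
  by right.
have [A [xA npA AU]] := open_punctured_basis oU Ux.
rewrite xE in xA.
have [n pn] : exists n, p (ldiv n (A `&` ~` F)) :=
  filter_ex (F := w) (filterI (F := (w * p)%g) xA wpF).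
have {pn} : translate p (val n).-1 (A `&` ~` F).
  by apply/translateE; rewrite posnat_predK.
set k := (val n).-1 => dAF.
have dA : translate p k A by apply: (filterS (F := translate p k)) dAF => y [].
have /beta_setC : translate p k (~` F).
  by apply: (filterS (F := translate p k)) dAF => y [].
have [|y yd] := punctured_lift p (translate p k) (beta_remainder_mull _ _ pN).
  by move=> dp; apply: npA; rewrite -dp.
by apply; apply: (UF y) => //; apply: AU; rewrite yd.
Qed.

Theorem corollary3p13 (p : beta posnat)
  (hp : smallest_ideal (beta posnat) p) :
  ~ normal_space (set_type (beta_remainder posnat `\ p)).
Proof.
move=> normal_p; have pN := smallest_ideal_remainder _ hp.
have [chi [chiM chi_indep]] := independent_parities.
have free : pattern_free chi p.
  apply: syndetic_pattern_free => // A pA.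
  exact: smallest_ideal_syndetic.
have [U [V [oU oV wU wV UV0]]] := normal_disjoint_open _ _ normal_p
  (closed_wing chi p true) (closed_wing chi p false) (wing_disjoint chi p).
have [A AP] := open_punctured_bases (translate p) oU.
have [B BP] := open_punctured_bases (translate p) oV.
have dAB k i j : ~ translate p k (A i `&` B j).
  move=> dk; have [npA AU _] := AP i; have [_ BV _] := BP j.
  have dA : translate p k (A i).
    by apply: (filterS (F := translate p k)) dk => y [].
  have dB : translate p k (B j).
    by apply: (filterS (F := translate p k)) dk => y [].
  have [|y yd] := punctured_lift p (translate p k) (beta_remainder_mull _ _ pN).
    by move=> dp; apply: npA; rewrite -dp.
  suff : (U `&` V) y by rewrite UV0.
  by split; [apply: AU|apply: BV]; rewrite yd.
have [C [D [CD0 AC BD]]] := countable_separation (translate p) A B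
  (fun i j => dAB i i j) (fun i j => dAB j i j).
have pC : p C.
  apply: (wing_adherent chi p true U) => // x k Ux xk; apply: AC.
  by have [_ _] := AP k; apply; [exact: Ux|].
have pD : p D.
  apply: (wing_adherent chi p false V) => // x k Vx xk; apply: BD.
  by have [_ _] := BP k; apply; [exact: Vx|].
have : p (C `&` D) by exact: (filterI (F := p)).
by rewrite CD0; exact: (@filter_not_empty _ (beta_sets p) _).
Qed.
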